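(* Let $\Delta$ be a veering triangulation of a connected 3-manifold $M$ (the interior of an oriented compact 3-manifold with torus boundary components), and let $\Phi$ be its flow graph. Then the infinitesimal components of $\Phi$ are exactly the infinitesimal cycles of walls of $\Delta$. Furthermore, $\Phi/{\sim}$ is a rooted height 1 tree, i.e. it has a unique vertex $v_0$ such that there is a directed edge from $v_0$ to every other vertex.
   Context: **Veering triangulations.** $M$ is the interior of an oriented compact 3-manifold $\overline{M}$ with torus boundary components. An ideal triangulation $\Delta$ of $M$ is a decomposition of $M$ into (finitely many) ideal tetrahedra (tetrahedra with their vertices removed) glued along pairs of faces. A taut structure is a labelling of the dihedral angles by $0$ or $\pi$ such that each tetrahedron has exactly two dihedral angles labelled $\pi$, at opposite edges, and the angle sum around each edge of the triangulation is $2\pi$. A transverse taut structure is a taut structure with a coorientation on each face such that for any edge labelled $0$ in a tetrahedron, exactly one of the two faces of that tetrahedron adjacent to it is cooriented out of the tetrahedron. Coorientations are taken to point upwards: the top (bottom) faces of a tetrahedron are the two faces cooriented out of (into) it, its top (bottom) edge is the $\pi$-edge between its top (bottom) faces, and its other four edges are its side edges. A veering structure is a coloring of the edges of $\Delta$ by red or blue such that, looking at each flat tetrahedron from above, going through its four side edges counter-clockwise starting from an endpoint of the top edge, the edges are colored red, blue, red, blue in that order. A veering triangulation is a transverse taut ideal triangulation with a veering structure. **Flow graph.** The flow graph $\Phi$ of $\Delta$ is the directed graph whose vertex set is the set of edges of $\Delta$, with 3 directed edges for each tetrahedron, going from its top edge and from each of its two side edges of opposite color to the top edge, into its bottom edge.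 **Strongly connected components.** For vertices $v,w$ of a directed graph $G$, write $v\gtrsim w$ if there is a directed edge path from $v$ to $w$, and $v\sim w$ if $v\gtrsim w$ and $w\gtrsim v$. Equivalence classes of $\sim$ are called strongly connected components. $G/{\sim}$ is the directed graph whose vertices are the equivalence classes $[v]$, with an edge from $[v]$ to $[w]$ if $v\gtrsim w$ and $[v]\neq[w]$. A strongly connected component $[v]$ is an infinitesimal component if $[v]$ has an incoming edge in $G/{\sim}$. **Walls.** Suppose there are tetrahedra $t_{i,j}$ of $\Delta$, $1\le i\le w+1$, $j\in\mathbb{Z}/h$, where $w\ge 2$, such that for $2\le i\le w$: (1) the bottom edge of $t_{i,j}$ is the top edge of $t_{i,j+1}$; (2) if $i$ is odd, the bottom edge of $t_{i,j}$ is a side edge of $t_{i-1,j}$ and $t_{i+1,j}$ and of no other tetrahedra in $\Delta$; if $i$ is even, the bottom edge of $t_{i,j}$ is a side edge of $t_{i-1,j+1}$ and $t_{i+1,j+1}$ and of no other tetrahedra in $\Delta$. Then the indexed multiset $\{t_{i,j}\}$ is called a wall of width $w$ (the $t_{i,j}$ for different $i,j$ need not be different tetrahedra); $h$ is implicitly taken to be the minimum possible value. For $2\le i\le w$, the bottom edge of $t_{i,j}$ has exactly one outgoing edge in $\Phi$, going to the bottom edge of $t_{i,j+1}$; the resulting cycle $c_i$ of $\Phi$ through the bottom edges of $t_{i,j}$, $j\in\mathbb{Z}/h$, has no edges exiting it. The cycles $c_i$, $2\le i\le w$, are called the infinitesimal cycles of the wall. An infinitesimal cycle is identified with its set of vertices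 when regarded as a strongly connected component. *)

(* Defs.v *)
From mathcomp Require Import all_boot fingroup perm.

Set Implicit Arguments.
Unset Strict Implicit.
Unset Printing Implicit Defensive.

(* A tetrahedron has vertex set 'I_4; "face f" is the face opposite vertex f,
   so that face f contains a set e of vertices iff f \notin e. *)
Definition v0 : 'I_4 := @Ordinal 4 0 isT.
Definition v1 : 'I_4 := @Ordinal 4 1 isT.
Definition v2 : 'I_4 := @Ordinal 4 2 isT.
Definition v3 : 'I_4 := @Ordinal 4 3 isT.

Definition medge : Type := {e : {set 'I_4} | #|e| == 2}.

Lemma pair_subproof (a b : 'I_4) : a != b -> #|[set a; b]| == 2.
Proof. by move=> ab; rewrite cards2 ab. Qed.

Definition medge_pair (a b : 'I_4) (ab : a != b) : medge :=
  exist _ [set a; b] (pair_subproof ab).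

Definition e01 : medge := @medge_pair v0 v1 isT.
Definition e02 : medge := @medge_pair v0 v2 isT.
Definition e03 : medge := @medge_pair v0 v3 isT.
Definition e12 : medge := @medge_pair v1 v2 isT.
Definition e13 : medge := @medge_pair v1 v3 isT.

Lemma opp_subproof (e : medge) : #|~: val e| == 2.
Proof. by rewrite cardsCs setCK card_ord (eqP (valP e)). Qed.

Definition opp_medge (e : medge) : medge := exist _ (~: val e) (opp_subproof e).

Lemma perm_medge_subproof (s : 'S_4) (e : medge) : #|s @: val e| == 2.
Proof. by rewrite card_imset ?(eqP (valP e)) //; apply: perm_inj. Qed.

Definition perm_medge (s : 'S_4) (e : medge) : medge :=
  exist _ (s @: val e) (perm_medge_subproof s e).

(* Oriented face gluings of finitely many tetrahedra.  The vertex labelling of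
   each tetrahedron is positive, i.e. det(p1-p0, p2-p0, p3-p0) > 0 for the
   positions p_a of its vertices.  Face f of t is glued to face
   [glue_perm t f f] of [glue_tet t f], vertex a != f of the face going to
   [glue_perm t f a]; the gluing respects the orientations iff this
   permutation is odd. *)
Record gluing (T : finType) := Gluing {
  glue_tet : T -> 'I_4 -> T;
  glue_perm : T -> 'I_4 -> 'S_4;
  glue_odd : forall t f, odd_perm (glue_perm t f);
  glue_tetK : forall t f, glue_tet (glue_tet t f) (glue_perm t f f) = t;
  glue_permK : forall t f,
    glue_perm (glue_tet t f) (glue_perm t f f) = (glue_perm t f)^-1%g;
  glue_neq : forall t f, (glue_tet t f, glue_perm t f f) != (t, f)
}.

Section Gluing.
Variables (T : finType) (D : gluing T).

Definition edge_glued : rel (T * medge) := fun x y =>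
  [exists f, (f \notin val x.2) &&
    (y == (glue_tet D x.1 f, perm_medge (glue_perm D x.1 f) x.2))].

Definition edge_class (x : T * medge) : {set T * medge} :=
  [set y | connect edge_glued x y].

(* An edge of the triangulation is the set of all its incidences with
   tetrahedra. *)
Definition edge : Type :=
  {E : {set T * medge} | E \in [set edge_class x | x : T * medge]}.

Lemma edge_of_subproof (x : T * medge) :
  edge_class x \in [set edge_class x | x : T * medge].
Proof. exact: imset_f. Qed.

Definition edge_of (x : T * medge) : edge :=
  exist _ (edge_class x) (edge_of_subproof x).

Definition tet_adj : rel T := fun t u => [exists f, u == glue_tet D t f].

Definition connected_manifold : Prop :=
  0 < #|T| /\ forall t u : T, connect tet_adj t u.

(* The link of the ideal vertex a of t is a closed, connected, oriented
   surface tiled by the triangles (t', a') in the class of (t, a).  The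
   triangle (t, a) has one corner (t, (a, b)) for each edge {a, b} of t and one
   side (t, (a, f)) for each face f of t containing a. *)
Definition cusp_glued : rel (T * 'I_4) := fun x y =>
  [exists f, (f != x.2) && (y == (glue_tet D x.1 f, glue_perm D x.1 f x.2))].

Definition corner_glued : rel (T * ('I_4 * 'I_4)) := fun x y =>
  [exists f, [&& f != x.2.1, f != x.2.2 &
    y == (glue_tet D x.1 f,
          (glue_perm D x.1 f x.2.1, glue_perm D x.1 f x.2.2))]].

Definition side_glued : rel (T * ('I_4 * 'I_4)) := fun x y =>
  let: (t, (a, f)) := x in
  y == (glue_tet D t f, (glue_perm D t f a, glue_perm D t f f)).

Definition link_flags (c : T * 'I_4) : pred (T * ('I_4 * 'I_4)) := fun x =>
  (x.2.1 != x.2.2) && connect cusp_glued c (x.1, x.2.1).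

(* Vanishing Euler characteristic, V - E + F = 0, of every link. *)
Definition torus_cusps : Prop := forall c : T * 'I_4,
  n_comp corner_glued (link_flags c) + #|[set x | connect cusp_glued c x]|
  = n_comp side_glued (link_flags c).

(* [is_pi t e] : the dihedral angle of t at e is pi (it is 0 otherwise). *)
Definition is_taut (is_pi : T -> pred medge) : Prop :=
  (forall t, exists e : medge, forall e',
     is_pi t e' = (e' == e) || (e' == opp_medge e)) /\
  (forall E : edge, #|[set x in val E | is_pi x.1 x.2]| = 2).

(* [outward t f] : the coorientation of face f points out of t. *)
Definition is_transverse (is_pi : T -> pred medge) (outward : T -> pred 'I_4) :
    Prop :=
  (forall t f, outward (glue_tet D t f) (glue_perm D t f f) = ~~ outward t f) /\
  (forall t e, ~~ is_pi t e ->
     #|[set f | (f \notin val e) && outward t f]| = 1).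

Definition is_top (is_pi : T -> pred medge) (outward : T -> pred 'I_4)
    (t : T) : pred medge := fun e =>
  is_pi t e && [forall f, (f \notin val e) ==> outward t f].

Definition is_bottom (is_pi : T -> pred medge) (outward : T -> pred 'I_4)
    (t : T) : pred medge := fun e =>
  is_pi t e && [forall f, (f \notin val e) ==> ~~ outward t f].

(* If the top edge is {a, b} and (a, b, c, d) is a positive labelling of t, the
   vertices of t seen from above are a, c, b, d in counter-clockwise order, so
   the side edges from a on are ac, cb, bd, da.  Both endpoints of the top edge
   are covered, since (b, a, d, c) is also positive. *)
Definition is_veering (is_pi : T -> pred medge) (outward : T -> pred 'I_4)
    (red : pred edge) : Prop :=
  forall (t : T) (s : 'S_4), ~~ odd_perm s ->
    is_top is_pi outward t (perm_medge s e01) ->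
    [/\ red (edge_of (t, perm_medge s e02)),
        ~~ red (edge_of (t, perm_medge s e12)),
        red (edge_of (t, perm_medge s e13))
      & ~~ red (edge_of (t, perm_medge s e03))].

End Gluing.

(* Edges that are not red are blue. *)
Record veering_triangulation (T : finType) := VeeringTriangulation {
  vt_gluing :> gluing T;
  is_pi : T -> pred medge;
  outward : T -> pred 'I_4;
  red : pred (edge vt_gluing);
  vt_torus : torus_cusps vt_gluing;
  vt_taut : is_taut vt_gluing is_pi;
  vt_transverse : is_transverse vt_gluing is_pi outward;
  vt_veering : is_veering is_pi outward red
}.

Section TopBottom.
Variables (T : finType) (V : veering_triangulation T).

Lemma top_bottom_exists t :
  (exists e, is_top (is_pi V) (outward V) t e) /\
  (exists e, is_bottom (is_pi V) (outward V) t e).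
Proof.
have [/= taut _] := vt_taut V; have [e pie] := taut t.
have [_ tr] := vt_transverse V.
have /cards2P[a [b [ab vE]]] : #|val e| == 2 := valP e.
have oE : val (opp_medge e) = ~: val e by [].
have /cards2P[c [d [cd vO]]] : #|~: val e| == 2 := valP (opp_medge e).
have memO x : (x \in [set c; d]) = (x \notin [set a; b]).
  by rewrite -vO inE vE.
have all4 x : [|| x == a, x == b, x == c | x == d].
  by have := memO x; rewrite !inE; do 4![case: (x == _)].
have [nca ncb nda ndb] : [/\ c != a, c != b, d != a & d != b].
  have := memO c; have := memO d; rewrite !inE !eqxx orbT /=.
  by move=> /esym/norP[-> ->] /esym/norP[-> ->].
have zero x y (xy : x != y) : x \in [set a; b] -> y \in [set c; d] ->
    ~~ is_pi V t (medge_pair xy).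
  move=> xe yo; rewrite pie; apply/norP; split; apply/eqP => /(congr1 val) /=.
    move/setP/(_ y); rewrite vE !inE eqxx orbT => /esym.
    by move: yo; rewrite memO !inE => /negbTE->.
  rewrite vO => /setP/(_ x); rewrite memO xe.
  by rewrite !inE eqxx.
have one x y x' y' : x \in [set a; b] -> y \in [set c; d] ->
    x' != y' -> (forall z, (z \notin [set x; y]) = (z \in [set x'; y'])) ->
    outward V t x' = ~~ outward V t y'.
  move=> xe yo x'y' mem; have xy : x != y.
    by apply/eqP => xy; move: yo; rewrite -xy memO xe.
  have /eqP/cards1P[z /setP zP] := tr t (medge_pair xy) (zero x y xy xe yo).
  have := zP x'; have := zP y'; rewrite !inE.
  have := mem x'; have := mem y'; rewrite !inE !eqxx orbT /= => -> -> /=.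
  move=> -> ->; case: (eqVneq x' z) => [<-|nx]; first by rewrite eq_sym x'y'.
  have := zP z; rewrite [in X in _ = X]inE eqxx inE => /andP[zz _].
  have : z \in [set x'; y'] by rewrite -mem.
  by rewrite !inE eq_sym (negbTE nx) /= eq_sym => ->.
have compl x y x' y' : uniq [:: x; y; x'; y'] ->
    (forall z, [|| z == x, z == y, z == x' | z == y']) ->
    forall z, (z \notin [set x; y]) = (z \in [set x'; y']).
  move=> u all z; rewrite !inE; move: u; rewrite /= !inE.
  have := all z.
  case: (eqVneq z x) => [->|_]; first by case: (x == y) (x == x') (x == y') => [] [] [].
  case: (eqVneq z y) => [->|_] /=; last by [].
  by move=> _; case: (y == x') (y == y') => [] [] //=; rewrite ?andbF.
have ac_bd : outward V t b = ~~ outward V t d.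
  apply: (one a c); rewrite ?inE ?eqxx ?orbT // 1?eq_sym //.
  apply: compl => [|z]; last by have := all4 z; do 4![case: (z == _)].
  rewrite /= !inE !negb_or eq_sym nca ab [a == d]eq_sym nda ncb cd.
  by rewrite [b == d]eq_sym ndb.
have ad_bc : outward V t b = ~~ outward V t c.
  apply: (one a d); rewrite ?inE ?eqxx ?orbT // 1?eq_sym //.
  apply: compl => [|z]; last by have := all4 z; do 4![case: (z == _)].
  rewrite /= !inE !negb_or eq_sym nda ab [a == c]eq_sym nca ndb.
  by rewrite [d == c]eq_sym cd [b == c]eq_sym ncb.
have bd_ac : outward V t a = ~~ outward V t c.
  apply: (one b d); rewrite ?inE ?eqxx ?orbT // 1?eq_sym //.
  apply: compl => [|z]; last by have := all4 z; do 4![case: (z == _)].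
  rewrite /= !inE !negb_or [b == d]eq_sym ndb [b == a]eq_sym ab.
  by rewrite [b == c]eq_sym ncb nda [d == c]eq_sym cd [a == c]eq_sym nca.
have inO f : f \notin val e -> outward V t f = ~~ outward V t a.
  rewrite -[_ \notin _]in_setC vO !inE => /orP[]/eqP->.
    by rewrite bd_ac negbK.
  by rewrite bd_ac -ad_bc ac_bd negbK.
have inE' f : f \notin val (opp_medge e) -> outward V t f = outward V t a.
  by rewrite oE in_setC negbK vE !inE => /orP[]/eqP-> //; rewrite ad_bc -bd_ac.
have pe : is_pi V t e by rewrite pie eqxx.
have po : is_pi V t (opp_medge e) by rewrite pie eqxx orbT.
case oa: (outward V t a); split; [exists (opp_medge e) | exists e
  | exists e | exists (opp_medge e)]; apply/andP; split => //;
  apply/forallP => f; apply/implyP => fN;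
  by rewrite ?(inO _ fN) ?(inE' _ fN) oa.
Qed.

Definition top_medge (t : T) : medge := xchoose (top_bottom_exists t).1.
Definition bottom_medge (t : T) : medge := xchoose (top_bottom_exists t).2.

Definition top_edge (t : T) : edge V := edge_of V (t, top_medge t).
Definition bottom_edge (t : T) : edge V := edge_of V (t, bottom_medge t).

(* The tetrahedra having E as a side edge, listed with multiplicity: once for
   each of their side edges that is identified with E. *)
Definition side_tets (E : edge V) : seq T :=
  [seq x.1 | x <- enum [set x in val E | ~~ is_pi V x.1 x.2]].

End TopBottom.

Record digraph := Digraph {
  vertex : finType;
  arrow : finType;
  source : arrow -> vertex;
  target : arrow -> vertex
}.

Section Components.
Variable G : digraph.

Definition step : rel (vertex G) := fun v w =>
  [exists a : arrow G, (source a == v) && (target a == w)].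

(* Directed paths, including the empty ones: v >~ w. *)
Definition reaches : rel (vertex G) := connect step.

Definition scc (v : vertex G) : {set vertex G} :=
  [set w | reaches v w && reaches w v].

(* The vertices of the quotient of G by ~. *)
Definition component : Type :=
  {C : {set vertex G} | C \in [set scc v | v : vertex G]}.

(* The edges of the quotient of G by ~. *)
Definition quotient_edge : rel component := fun A B =>
  (A != B) && [exists v in val A, exists w in val B, reaches v w].

Definition infinitesimal (B : component) : Prop :=
  exists A, quotient_edge A B.

End Components.

Section FlowGraph.
Variables (T : finType) (V : veering_triangulation T).

(* (t, e) indexes an arrow of the flow graph from e to the bottom edge of t. *)
Definition flow_arrow : pred (T * medge) := fun x =>
  (x.2 == top_medge V x.1) ||
  (~~ is_pi V x.1 x.2 && (red (edge_of V x) != red (top_edge V x.1))).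

Definition flow_graph : digraph :=
  @Digraph (edge V) {x : T * medge | flow_arrow x}
    (fun a => edge_of V (val a))
    (fun a => bottom_edge V (val a).1).

(* Only the values t i j with 1 <= i <= w + 1 matter; 'I_h with the cyclic
   successor ordS stands for Z/h.  The last clause says that h is the least
   period in j of the family. *)
Definition is_wall (w h : nat) (t : nat -> 'I_h -> T) : Prop :=
  [/\ 2 <= w,
      0 < h,
      forall i j, 2 <= i <= w ->
        bottom_edge V (t i j) = top_edge V (t i (ordS j)),
      forall i j, 2 <= i <= w ->
        let k := if odd i then j else ordS j in
        perm_eq (side_tets (bottom_edge V (t i j))) [:: t i.-1 k; t i.+1 k]
    & forall d, 0 < d < h ->
        ~ (forall i j, 1 <= i <= w.+1 -> t i (iter d (@ordS h) j) = t i j)].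

Definition infinitesimal_cycle (C : {set edge V}) : Prop :=
  exists w h (t : nat -> 'I_h -> T) (i : nat),
    [/\ is_wall w t, 2 <= i <= w & C = [set bottom_edge V (t i j) | j : 'I_h]].

End FlowGraph.

(* The unique vertex with an edge to every other vertex is the root, and the
   tree has no further edges. *)
Definition rooted_height1_tree (Q : Type) (e : rel Q) : Prop :=
  exists r : Q,
    unique (fun v => forall u, u <> v -> e v u) r /\
    (forall u v, e u v -> u = r).

(* Main.v *)
Require Import Defs.
From mathcomp Require Import all_boot fingroup perm.

(* Each tetrahedron gets a frame with top edge 01 and bottom edge 23; its side
   edges are then 02, 13 (red) and 12, 03 (blue).  A face has two edges of one
   colour, the top edge of the tetrahedron below and the bottom edge of the one
   above, and a third edge of the other colour.

   Let S be a nonempty set of edges closed under predecessors in the flow graph,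
   and call a face bad if its third edge is outside S.  Then all edges of a bad
   face are outside S, and badness is constant along each ladder of the cusp
   triangulations.  Two adjacent ladders are bad together because both their
   poles contain third edges of faces.  So a tetrahedron with both a bad and a
   good face would have neighbours of the same kind, hence all tetrahedra would
   have top and bottom edges of the same colour, and the fan of a side edge
   would never end.  So all faces are bad, which is impossible as S is
   nonempty, or none is: then an edge outside S is the third edge of no face,
   that is, it has one side tetrahedron on each side and one outgoing arrow.

   Applied to the complement of what an infinitesimal component reaches, this
   shows that such a component is a cycle of edges, each the bottom edge of one
   tetrahedron and the top edge of the next, which is the infinitesimal cycle of
   a wall of width 2. *)

Set Implicit Arguments.
Unset Strict Implicit.
Unset Printing Implicit Defensive.

(** An injection of a finite set that maps the points satisfying [P] into themselves permutes them.
    This turns one-way propagation of badness into an equivalence. *)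
Lemma inj_invariant (X : finType) (f : X -> X) (P : pred X) :
  injective f -> (forall x, P x -> P (f x)) -> forall x, P (f x) = P x.
Proof.
move=> f_inj Pf x; apply/idP/idP => [Pfx|]; last exact: Pf.
have /eqP fP : f @: [set y | P y] == [set y | P y].
  rewrite eqEcard card_imset // leqnn andbT.
  by apply/subsetP => _ /imsetP[y + ->]; rewrite !inE; apply: Pf.
have : f x \in f @: [set y | P y] by rewrite fP inE.
by rewrite mem_imset // inE.
Qed.

(** * Combinatorics of faces, fans and ladders *)

Section Ladders.

Variables (T E : finType).
Implicit Types (t u : T) (x y z : T * bool) (k : bool).

Definition flip x : T * bool := (x.1, ~~ x.2).

Lemma flipK : involutive flip.
Proof. by case=> t i; rewrite /flip /= negbK. Qed.

Lemma flip_neq x : flip x != x.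
Proof. by case: x => t []; rewrite xpair_eqE eqxx. Qed.

Lemma same_tet x y : x.1 = y.1 -> x = y \/ x = flip y.
Proof.
by case: x y => t i [u j] /= ->; case: i; case: j; [left|right|right|left].
Qed.

Variables (up : T * bool -> T * bool) (c : T -> bool).
Variables (top bot : T -> E) (side : bool -> T * bool -> E) (col : E -> bool).

(** A pair [x] stands for a top face of [x.1], and [flip x] for the other one. [turn k x] is the top
    face of the tetrahedron above [x] that meets [x] in the side edge of colour [k] of that
    tetrahedron. *)
Definition turn k x := if k then flip (up x) else up x.

Lemma turn1 k x : (turn k x).1 = (up x).1.
Proof. by case: k. Qed.

Lemma flip_turn k x : flip (turn k x) = turn (~~ k) x.
Proof. by case: k; rewrite //= flipK. Qed.

Hypothesis up_inj : injective up.

Lemma turn_inj k : injective (turn k).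
Proof. by case: k => //= x y /(inv_inj flipK)/up_inj. Qed.

(** How the edges of a face change roles between the tetrahedra below and above it: the third edge
    stays a side edge, the top edge becomes one, and the remaining edge becomes the bottom edge. *)
Hypothesis side_turn : forall k x, c x.1 != k -> side k x = side k (turn k x).
Hypothesis top_turn : forall x, top x.1 = side (c x.1) (turn (c x.1) x).
Hypothesis side_bot : forall x, side (c x.1) x = bot (up x).1.
Hypothesis col_side : forall k x, col (side k x) = k.
Hypothesis top_bij : bijective top.
Hypothesis bot_bij : bijective bot.
Hypothesis fan_finite : forall k x, exists n, c (iter n (turn k) x).1 = k.

Lemma bot_up_col x y : (up x).1 = (up y).1 -> c x.1 = c y.1.
Proof.
move=> xy; rewrite -(col_side (c x.1) x) side_bot xy -side_bot.
exact: col_side.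
Qed.

Lemma iter_turn_side k x n :
  (forall m, m < n -> c (iter m (turn k) x).1 != k) ->
  side k (iter n (turn k) x) = side k x.
Proof.
elim: n => [//|n IH] ck /=; rewrite -side_turn ?IH // => [m mn|].
  exact: ck (ltnW mn).
exact: ck.
Qed.

Variable S : {set E}.
Hypothesis S_closed : forall t, bot t \in S ->
  top t \in S /\ forall i, side (~~ c t) (t, i) \in S.

(** One inclusion is the closure of [S]; as [top] and [bot] are bijections, both sets of tetrahedra
    have as many elements as [S]. *)
Lemma bot_top t : (bot t \in S) = (top t \in S).
Proof.
have /eqP/setP/(_ t) : [set u | bot u \in S] == [set u | top u \in S].
  rewrite eqEcard; apply/andP; split.
    by apply/subsetP => u; rewrite !inE => /S_closed[].
  have card f : bijective f -> #|[set u | f u \in S]| = #|S|.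
    move=> f_bij; rewrite -[RHS](on_card_preimset (f := f)).
      by apply: eq_card => u; rewrite !inE.
    exact: onW_bij.
  by rewrite !card.
by rewrite !inE.
Qed.

(* A face has two edges of one colour and a third one of the other colour; [x]
   is bad if the third one lies outside S. *)
Definition bad x := side (~~ c x.1) x \notin S.

Lemma bad_top x : bad x -> top x.1 \notin S.
Proof.
apply: contraNN; rewrite -bot_top => /S_closed[_ /(_ x.2)].
by case: x.
Qed.

(** The third edge of the new face is the third edge of [x] if the tetrahedra below and above [x]
    agree in colour, and the top edge of [x.1] otherwise. *)
Lemma bad_ladder1 x : bad x -> bad (turn (~~ c (up x).1) x).
Proof.
move=> bx; rewrite /bad turn1; case: (eqVneq (c (up x).1) (c x.1)) => [->|cu].
  by rewrite -side_turn //; case: (c x.1).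
have -> : ~~ c (up x).1 = c x.1 by move: cu; case: (c x.1); case: (c _).
by rewrite -top_turn bad_top.
Qed.

Lemma bad_ladder x : bad (turn (~~ c (up x).1) x) = bad x.
Proof.
apply: (inj_invariant (f := fun y => turn (~~ c (up y).1) y)) => [y z|].
  move=> yz; have := congr1 fst yz; rewrite !turn1 => uyz.
  by move: yz; rewrite uyz => /turn_inj.
exact: bad_ladder1.
Qed.

Lemma bad_side x k : bad x -> side k x \notin S.
Proof.
move=> bx; case: (eqVneq k (c x.1)) => [->|kc]; last first.
  by have -> : k = ~~ c x.1 by move: kc; case: k; case: (c x.1).
rewrite side_bot bot_top -(turn1 (~~ c (up x).1)); apply: bad_top.
exact: bad_ladder1.
Qed.

(** Badness propagates downwards here: the new face contains the third edge of [x], and the side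
    edges of a bad face lie outside [S]. *)
Lemma bad_coladder x : bad (turn (~~ c x.1) x) = bad x.
Proof.
have inj : injective (fun y => turn (~~ c y.1) y).
  move=> y z yz; have := congr1 fst yz; rewrite !turn1 => /bot_up_col cyz.
  by move: yz; rewrite cyz => /turn_inj.
apply: esym; rewrite -[LHS]negbK -[RHS]negbK; congr (~~ _); apply: esym.
apply: (inj_invariant (P := fun y => ~~ bad y) inj) => y; apply: contraNN.
move/bad_side => /(_ (~~ c y.1)); rewrite -side_turn //.
by case: (c _).
Qed.

(** Turning around the top edge of [x.1] on one side visits its fan. The first tetrahedron there of
    the colour of the edge is the last one: the edge is the bottom edge of the next. *)
Lemma fan_end x : exists n,
  [/\ c (iter n.+1 (turn (c x.1)) x).1 = c x.1,
      forall m, m < n -> c (iter m.+1 (turn (c x.1)) x).1 != c x.1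
    & top x.1 = bot (up (iter n.+1 (turn (c x.1)) x)).1].
Proof.
pose k := c x.1; pose y := turn k x.
have ex : exists n, c (iter n (turn k) y).1 == k.
  by have [n /eqP cn] := fan_finite k y; exists n.
have [n /eqP cn nmin] := ex_minnP ex.
have lt m : m < n -> c (iter m (turn k) y).1 != k.
  by move=> mn; apply/negP => /nmin; rewrite leqNgt mn.
exists n; split; rewrite ?iterSr //.
  by move=> m mn; rewrite iterSr; exact: lt.
by rewrite top_turn -/k -/y -(iter_turn_side lt) -{1}cn side_bot.
Qed.

(** Cancelling one turn would leave a shorter walk from [flip x] to [x], whose colour does not occur
    that early; the walk of length 0 is excluded by [flip_neq]. *)
Lemma iter_turn_neq x n :
  (forall m, m < n -> c (iter m.+1 (turn (c x.1)) (flip x)).1 != c x.1) ->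
  iter n.+1 (turn (c x.1)) (flip x) <> turn (c x.1) x.
Proof.
case: n => [|n] min /= /turn_inj; first exact/eqP/flip_neq.
by move=> e; have := min n (leqnn _); rewrite /= e eqxx.
Qed.

(* The two ladders of a cusp on either side of a ladderpole edge are bad
   together: otherwise the tetrahedra in the second one all have the colour of
   the pole, and one of their edges on the opposite pole never ends. *)
Lemma bad_pole x : bad (flip x) -> bad (turn (c x.1) x).
Proof.
move=> b0; apply: contraT => nb0.
pose k := c x.1.
(* A counterexample of colour [k]; each one will yield another, [z']. *)
pose P z := [&& c z.1 == k, bad (flip z) & ~~ bad (turn k z)].
have step z : P z -> c (turn k z).1 = k /\
    exists2 z', P z' & turn k z' = turn (~~ k) (turn k z).
  case/and3P => /eqP cz bz nbz; pose y := turn k z.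
  have cy : c y.1 = k.
    (* Otherwise the third edge of [y] is the top edge of [z.1], which is outside [S] as [flip z] is
       bad. *)
    apply/eqP; apply: contraNT nbz => cy; rewrite /bad -/y.
    have -> : ~~ c y.1 = k by move: cy; case: (c _); case: (k).
    by rewrite -{1}cz /y -cz -top_turn (bad_top bz).
  split=> //.
  have [n []] := fan_end (flip z); rewrite /= cz => cn lt topn.
  set z' := iter n.+1 (turn k) (flip z) in cn topn.
  have z'y : z' <> y.
    have := @iter_turn_neq z n; rewrite cz; apply; exact: lt.
  (* Both [z'] and [y] lie below the tetrahedron whose bottom edge is the top edge of [z.1]; being
     distinct, they are its two bottom faces. *)
  have upz' : turn k z' = flip (turn k y).
    have : (turn k z').1 = (turn k y).1.
      apply: (bij_inj bot_bij); rewrite !turn1 -topn.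
      by rewrite -side_bot cy /y -{1 2}cz top_turn.
    by case/same_tet => // /turn_inj.
  exists z'; last by rewrite upz' flip_turn.
  rewrite /P cn eqxx /=; apply/andP; split; last first.
    by rewrite upz' flip_turn -cy bad_coladder.
  (* Before its end the fan runs along a ladder. *)
  have walk m : m <= n -> bad (iter m (turn k) (flip z)).
    elim: m => [//|m IH] mn /=.
    have := lt m mn; rewrite -bad_ladder /= turn1 => cm.
    have -> : turn k (iter m (turn k) (flip z)) =
        turn (~~ c (up (iter m (turn k) (flip z))).1)
          (iter m (turn k) (flip z)).
      by congr turn; move: cm; case: (c _); case: (k).
    by rewrite !bad_ladder; apply/IH/ltnW.
  have := walk n (leqnn n); rewrite -bad_ladder.
  have -> : c (up (iter n (turn k) (flip z))).1 = k.
    by move: cn; rewrite /z' /= turn1.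
  by rewrite -flip_turn.
have Px : P x by rewrite /P eqxx b0 nb0.
have [n] := fan_finite (~~ k) (turn k x).
(* Turning with the opposite colour thus meets only tetrahedra of colour [k]. *)
have orbit m : exists2 z, P z & iter m (turn (~~ k)) (turn k x) = turn k z.
  elim: m => [|m [z Pz IH]]; first by exists x.
  by have [_ [z' Pz' e]] := step z Pz; exists z' => //=; rewrite IH e.
by have [z /step[cz _] ->] := orbit n; rewrite cz; case: (k).
Qed.

Lemma bad_poleE x : bad (turn (c x.1) x) = bad (flip x).
Proof.
rewrite -{1 2}(flipK x).
apply: (inj_invariant (f := fun y => turn (c y.1) (flip y))) => [y z yz|y by_].
  have := congr1 fst yz; rewrite !turn1 => /bot_up_col /= cyz.
  by move: yz; rewrite cyz => /turn_inj /(inv_inj flipK).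
by apply: (@bad_pole (flip y)); rewrite flipK.
Qed.

Hypothesis tets_connected : forall P : pred T,
  (forall x, P x.1 = P (up x).1) -> forall t u, P t = P u.

Lemma no_bad : S != set0 -> forall x, ~~ bad x.
Proof.
move=> /set0Pn[e eS] x.
pose mixed t := bad (t, true) != bad (t, false).
have mixedE y : mixed y.1 = (bad y != bad (flip y)).
  by case: y => t [] //; rewrite /mixed eq_sym.
(* Of the two top faces of the tetrahedron above [y], one is as bad as [y] and the other as bad as
   [flip y]. *)
have mixed_up y : mixed y.1 = mixed (up y).1.
  rewrite mixedE -(turn1 (c y.1)) mixedE flip_turn bad_poleE bad_coladder.
  by rewrite eq_sym.
have [mx|nmx] := boolP (mixed x.1).
  have all_mixed t : mixed t by rewrite -(tets_connected mixed_up x.1).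
  (* If the colours differed, both top faces of the tetrahedron above [y] would be as bad as [y]. *)
  have cc y : c y.1 = c (up y).1.
    apply/eqP; apply: contraT => cy.
    have := all_mixed (up y).1; rewrite -(turn1 (c y.1)) mixedE flip_turn.
    have e' : c y.1 = ~~ c (up y).1 by move: cy; do 2![case: (c _)].
    by rewrite bad_coladder e' bad_ladder eqxx.
  have [n cn] := fan_finite (~~ c x.1) x.
  by move: cn; rewrite (tets_connected cc _ x.1); case: (c _).
have no_mixed t : ~~ mixed t by rewrite -(tets_connected mixed_up x.1).
have bad_flip y : bad (flip y) = bad y.
  by have := no_mixed y.1; rewrite mixedE negbK => /eqP.
have bad_tet y : bad y = bad (y.1, true).
  by case: y => t [] //; rewrite -bad_flip.
have bad_up y : bad (y.1, true) = bad ((up y).1, true).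
  by rewrite -bad_tet -(turn1 (c y.1)) -bad_tet bad_poleE bad_flip.
apply/negP; rewrite bad_tet; have [top' _ topK] := top_bij.
rewrite (tets_connected (P := fun t => bad (t, true)) bad_up _ (top' e)).
by move/bad_top; rewrite /= topK eS.
Qed.

End Ladders.

(** * Vertices and edges of a model tetrahedron *)

Local Open Scope group_scope.

Definition e23 : medge := @medge_pair v2 v3 isT.

Lemma ord4P (x : 'I_4) : [\/ x = v0, x = v1, x = v2 | x = v3].
Proof.
by case: x => [[|[|[|[|//]]]] lt];
  [apply: Or41|apply: Or42|apply: Or43|apply: Or44]; apply: val_inj.
Qed.

Lemma perm4_ext (r s : 'S_4) :
  r v0 = s v0 -> r v1 = s v1 -> r v2 = s v2 -> r v3 = s v3 -> r = s.
Proof.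
by move=> r0 r1 r2 r3; apply/permP => x; case: (ord4P x) => ->.
Qed.

(** In suitable frames a top face is opposite [v3] and a bottom face opposite [v0], so these are the
    orientation-respecting gluings of the two. *)
Lemma odd_perm4 (r : 'S_4) : odd_perm r -> r v3 = v0 ->
  [\/ [/\ r v0 = v1, r v1 = v2 & r v2 = v3],
      [/\ r v0 = v3, r v1 = v1 & r v2 = v2]
    | [/\ r v0 = v2, r v1 = v3 & r v2 = v1]].
Proof.
move=> odd_r r3.
have even (s : 'S_4) : ~~ odd_perm s -> r <> s.
  by move=> es rs; move: es; rewrite -rs odd_r.
have neq (x y : 'I_4) : x != y -> r x <> r y.
  by move=> /eqP xy /perm_inj.
have n01 := neq v0 v1 isT; have n02 := neq v0 v2 isT; have n03 := neq v0 v3 isT.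
have n12 := neq v1 v2 isT; have n13 := neq v1 v3 isT; have n23 := neq v2 v3 isT.
rewrite !r3 in n03 n13 n23.
case: (ord4P (r v0)) => r0; rewrite ?r0 // in n01 n02 n03 *;
  case: (ord4P (r v1)) => r1; rewrite ?r1 // in n01 n12 n13 *;
  case: (ord4P (r v2)) => r2; rewrite ?r2 // in n02 n12 n23 *.
- by constructor.
- case: (@even (tperm v0 v1 * tperm v0 v3));
  first by rewrite odd_permM !odd_tperm.
  by apply: perm4_ext; rewrite ?r0 ?r1 ?r2 ?r3 permM !permE.
- case: (@even (tperm v0 v2 * tperm v0 v3));
  first by rewrite odd_permM !odd_tperm.
  by apply: perm4_ext; rewrite ?r0 ?r1 ?r2 ?r3 permM !permE.
- by constructor 3.
- by constructor 2.
- case: (@even (tperm v0 v3 * tperm v1 v2));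
  first by rewrite odd_permM !odd_tperm.
  by apply: perm4_ext; rewrite ?r0 ?r1 ?r2 ?r3 permM !permE.
Qed.

Lemma perm_medgeM (r s : 'S_4) (e : medge) :
  perm_medge (r * s) e = perm_medge s (perm_medge r e).
Proof.
apply: val_inj => /=; rewrite -imset_comp.
by apply: eq_imset => x; rewrite permM.
Qed.

Lemma perm_medge_inj (s : 'S_4) : injective (perm_medge s).
Proof.
move=> d e /(congr1 val) /= de; apply: val_inj.
exact: imset_inj (@perm_inj _ s) _ _ de.
Qed.

Lemma perm_medge1 (e : medge) : perm_medge 1 e = e.
Proof.
apply: val_inj => /=; rewrite -[RHS]imset_id.
by apply: eq_imset => x; rewrite perm1.
Qed.

Lemma perm_medgeK (s : 'S_4) (e : medge) : perm_medge s (perm_medge s^-1 e) = e.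
Proof.
by rewrite -perm_medgeM mulVg perm_medge1.
Qed.

Lemma perm_medge_pair (s : 'S_4) (a b a' b' : 'I_4) (ab : a != b)
    (ab' : a' != b') :
  s a = a' /\ s b = b' \/ s a = b' /\ s b = a' ->
  perm_medge s (medge_pair ab) = medge_pair ab'.
Proof.
move=> sab; apply: val_inj => /=; rewrite imsetU1 imset_set1.
by case: sab => [[-> ->]|[-> ->]] //; rewrite setUC.
Qed.

Lemma medgeP (e : medge) :
  [\/ e = e01, e = e23, e = e02 \/ e = e12 | e = e03 \/ e = e13].
Proof.
have /cards2P[a [b [ab ve]]] := valP e.
have -> : e = medge_pair ab by apply: val_inj.
clear ve.
have sym (a' b' : 'I_4) (ab1 : a' != b') (ab2 : b' != a') :
    medge_pair ab1 = medge_pair ab2.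
  by apply: val_inj; rewrite /= setUC.
have irr (a' b' : 'I_4) (ab1 ab2 : a' != b') : medge_pair ab1 = medge_pair ab2.
  exact: val_inj.
have close (d : medge) : d = e01 \/ d = e23 \/ (d = e02 \/ d = e12) \/
    (d = e03 \/ d = e13) ->
  [\/ d = e01, d = e23, d = e02 \/ d = e12 | d = e03 \/ d = e13].
  by case=> [|[|[|]]];
    [constructor 1|constructor 2|constructor 3|constructor 4].
apply: close; case: (ord4P a) ab => ->; case: (ord4P b) => -> // ab;
  first [rewrite (irr _ _ ab isT); by auto | rewrite (@sym _ _ ab isT);
    by auto].
Qed.

Lemma mem_perm_medge (s : 'S_4) (e : medge) x :
  (s x \in val (perm_medge s e)) = (x \in val e).
Proof. by rewrite /= mem_imset //; apply: perm_inj. Qed.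

Lemma even_frame (e : medge) : exists s : 'S_4,
  ~~ odd_perm s && (perm_medge s e01 == e).
Proof.
have /cards2P[a [b [ab ve]]] := valP e.
pose s1 := tperm v0 a; pose s := s1 * tperm (s1 v1) b.
have sa : s v0 = a.
  rewrite permM tpermL tpermD //; last by rewrite eq_sym.
  by rewrite -(tpermL v0 a) (inj_eq perm_inj).
have sb : s v1 = b by rewrite permM tpermL.
have se : perm_medge s e01 = e.
  by apply: val_inj; rewrite ve /= imsetU1 imset_set1 sa sb.
have [odd_s|] := boolP (odd_perm s); last by exists s; rewrite se eqxx andbT.
exists (tperm v0 v1 * s); rewrite odd_permM odd_s odd_tperm /= perm_medgeM.
rewrite -[X in _ == X]se; apply/eqP; congr perm_medge.
by apply: perm_medge_pair; rewrite tpermL tpermR; right.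
Qed.

(** The even symmetry relating the two frames of a tetrahedron. *)
Definition swap4 : 'S_4 := tperm v0 v1 * tperm v2 v3.

Lemma swap4E :
  (swap4 v0 = v1) * (swap4 v1 = v0) * (swap4 v2 = v3) * (swap4 v3 = v2).
Proof. by rewrite !permM !permE. Qed.

Lemma swap4K : swap4 * swap4 = 1.
Proof. by apply: perm4_ext; rewrite permM !swap4E perm1. Qed.

(** * Frames of tetrahedra and gluings read in them *)

Section Frames.

Variables (T : finType) (V : veering_triangulation T).
Implicit Types (t u : T) (x y : T * bool) (k : bool) (p q : T * medge).

(* Both frames of a tetrahedron are positive labellings whose first two
   vertices span the top edge. *)
Definition tet_frame t : 'S_4 := xchoose (even_frame (top_medge V t)).

Definition frame x : 'S_4 :=
  if x.2 then swap4 * tet_frame x.1 else tet_frame x.1.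

Lemma frame_even x : ~~ odd_perm (frame x).
Proof.
have /andP[ev _] := xchooseP (even_frame (top_medge V x.1)).
by rewrite /frame; case: x.2; rewrite ?odd_permM ?odd_tperm.
Qed.

Lemma frame_flip x : frame (flip x) = swap4 * frame x.
Proof. by case: x => t [] //=; rewrite /frame /= mulgA swap4K mul1g. Qed.

Lemma frame_top x : perm_medge (frame x) e01 = top_medge V x.1.
Proof.
have /andP[_ /eqP e] := xchooseP (even_frame (top_medge V x.1)).
rewrite /frame; case: x.2; last exact: e.
rewrite perm_medgeM -[RHS]e; congr perm_medge; apply: perm_medge_pair.
by rewrite !swap4E; right.
Qed.

Lemma top_medgeP t : is_top (is_pi V) (outward V) t (top_medge V t).
Proof. exact: xchooseP. Qed.

Lemma bottom_medgeP t : is_bottom (is_pi V) (outward V) t (bottom_medge V t).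
Proof. exact: xchooseP. Qed.

Lemma bottom_neq_top t : bottom_medge V t <> top_medge V t.
Proof.
move=> bt; have /andP[_ /forallP in_] := bottom_medgeP t.
have /andP[_ /forallP out] := top_medgeP t.
have := mem_perm_medge (frame (t, false)) e01 v2.
rewrite frame_top /= !inE /= => /negbT nin.
have := in_ (frame (t, false) v2); rewrite bt nin /=.
by have := out (frame (t, false) v2); rewrite nin /= => ->.
Qed.

Lemma bottom_opp t : bottom_medge V t = opp_medge (top_medge V t).
Proof.
have [/(_ t)[e pie] _] := vt_taut V.
have /andP[pt _] := top_medgeP t; have /andP[pb _] := bottom_medgeP t.
have := @bottom_neq_top t; rewrite !pie in pt pb.
have oppK : opp_medge (opp_medge e) = e by apply: val_inj; rewrite /= setCK.
by case/orP: pt => /eqP ->; case/orP: pb => /eqP ->; rewrite ?oppK.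
Qed.

Lemma frame_bottom x : perm_medge (frame x) e23 = bottom_medge V x.1.
Proof.
rewrite bottom_opp -(frame_top x); apply: val_inj => /=.
apply/setP => y; rewrite -(permKV (frame x) y) inE !mem_imset //;
  try exact: perm_inj.
by case: (ord4P ((frame x)^-1 y)) => ->; rewrite !inE.
Qed.

Lemma is_piE t e :
  is_pi V t e = (e == top_medge V t) || (e == bottom_medge V t).
Proof.
have [/(_ t)[e' pie] _] := vt_taut V.
have /andP[pt _] := top_medgeP t; rewrite bottom_opp pie.
have oppK : opp_medge (opp_medge e') = e' by apply: val_inj; rewrite /= setCK.
by move: pt; rewrite pie => /orP[]/eqP ->; rewrite ?oppK // orbC.
Qed.

Lemma outwardE x (a : 'I_4) :
  outward V x.1 (frame x a) = (a == v2) || (a == v3).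
Proof.
have /andP[_ /forallP /(_ (frame x a)) in_] := bottom_medgeP x.1.
have /andP[_ /forallP /(_ (frame x a)) out] := top_medgeP x.1.
move: in_ out; rewrite -(frame_top x) -(frame_bottom x) !mem_perm_medge.
by case: (ord4P a) => ->; rewrite !inE //=; case: (outward _ _ _).
Qed.

Definition tet_red t : bool := red (top_edge V t).

Definition side_inc k x : T * medge :=
  (x.1, perm_medge (frame x) (if k then e02 else e12)).

Definition top_inc t : T * medge := (t, top_medge V t).
Definition bot_inc t : T * medge := (t, bottom_medge V t).

Definition side_edge k x : edge V := edge_of V (side_inc k x).

Lemma red_side k x : red (side_edge k x) = k.
Proof.
have := @vt_veering _ V x.1 (frame x) (frame_even x).
rewrite frame_top => /(_ (top_medgeP _))[r b _ _].
by case: k; [exact: r | exact: negbTE b].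
Qed.

Lemma side_inc_flip x :
  side_inc true (flip x) = (x.1, perm_medge (frame x) e13) /\
  side_inc false (flip x) = (x.1, perm_medge (frame x) e03).
Proof.
rewrite /side_inc frame_flip !(perm_medgeM swap4).
by split => /=; congr (_, perm_medge _ _); apply: perm_medge_pair;
  rewrite !swap4E; left.
Qed.

Lemma incP p : [\/ p = top_inc p.1, p = bot_inc p.1
  | exists k x, x.1 = p.1 /\ p = side_inc k x].
Proof.
case: p => t e /=; rewrite /top_inc /bot_inc.
rewrite -(perm_medgeK (frame (t, false)) e).
rewrite -(frame_top (t, false)) -(frame_bottom (t, false)).
have [r b] := side_inc_flip (t, false).
case: (medgeP (perm_medge (frame (t, false))^-1 e)) =>
  [->|->|[]->|[]->]; [by constructor 1|by constructor 2|..]; constructor 3.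
- by exists true, (t, false).
- by exists false, (t, false).
- by exists false, (t, true).
- by exists true, (t, true).
Qed.

Definition up_perm x : 'S_4 := glue_perm V x.1 (frame x v3).

(* The top face of [x.1] seen from frame [x] (the one opposite vertex v3) is
   glued to the bottom face seen from frame [up x] (the one opposite v0). *)
Definition up x : T * bool :=
  let u := glue_tet V x.1 (frame x v3) in
  (u, frame (u, true) v0 == up_perm x (frame x v3)).

(** The glued face is cooriented into the upper tetrahedron, so it is opposite [v0] or [v1] in
    either frame; the test in [up] picks the frame where it is [v0]. *)
Lemma frame_up x : frame (up x) v0 = up_perm x (frame x v3).
Proof.
have [/(_ x.1 (frame x v3)) out _] := vt_transverse V.
move: out; rewrite (outwardE x v3) /= -/(up_perm x).
set u := glue_tet _ _ _; set g := up_perm x _ => out.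
rewrite /up -/u -/g; case: eqP => // ne.
have fl : frame (u, true) = swap4 * frame (u, false) by [].
have := outwardE (u, false) ((frame (u, false))^-1 g).
rewrite permKV out; case: (ord4P ((frame (u, false))^-1 g)) => e.
- by rewrite -e permKV.
- by move=> _; case: ne; rewrite fl permM swap4E -e permKV.
- by rewrite e.
- by rewrite e.
Qed.

Lemma up_glueK x : glue_tet V (up x).1 (frame (up x) v0) = x.1 /\
  glue_perm V (up x).1 (frame (up x) v0) = (up_perm x)^-1.
Proof. by rewrite frame_up; split; [exact: glue_tetK|exact: glue_permK]. Qed.

Lemma frame_inj3 t (i j : bool) a : frame (t, i) a = frame (t, j) a -> i = j.
Proof.
by case: i; case: j => //; rewrite /frame /= permM => /perm_inj;
  case: (ord4P a) => ->; rewrite swap4E => /(congr1 val).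
Qed.

Lemma up_inj : injective up.
Proof.
move=> x y xy; have [tx px] := up_glueK x; have [ty py] := up_glueK y.
have txy : x.1 = y.1 by rewrite -tx -ty xy.
have := frame_up x; rewrite xy frame_up => e.
have pxy : up_perm x = up_perm y by apply: invg_inj; rewrite -px -py xy.
move: e; rewrite pxy => /perm_inj.
by case: x y txy {xy tx px ty py pxy} => t i [u j] /= -> /frame_inj3 ->.
Qed.

Lemma edge_glued_sym : symmetric (edge_glued V).
Proof.
suff imp p q : edge_glued V p q -> edge_glued V q p.
  by move=> p q; apply/idP/idP; apply: imp.
case/existsP => f /andP[fN /eqP ->]; apply/existsP.
exists (glue_perm V p.1 f f).
rewrite mem_perm_medge fN /= glue_tetK glue_permK -perm_medgeM mulgV.
by rewrite perm_medge1 -surjective_pairing.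
Qed.

Lemma edge_of_connect p q :
  edge_of V p = edge_of V q <-> connect (edge_glued V) p q.
Proof.
have sym := sym_connect_sym edge_glued_sym.
split=> [/(congr1 val) /= /setP /(_ q)|pq]; first by rewrite !inE connect0.
apply: val_inj; apply/setP => r /=; rewrite !inE.
exact: same_connect.
Qed.

Lemma mem_edge p (E : edge V) : (p \in val E) = (edge_of V p == E).
Proof.
case: E => C CE; have [q _ Cq] := imsetP CE.
have -> : exist (fun C => C \in _) C CE = edge_of V q by apply: val_inj.
rewrite /= inE; apply/idP/eqP => [/edge_of_connect ->//|/esym e].
by apply/edge_of_connect.
Qed.

Lemma edge_of_glued p q : edge_glued V p q -> edge_of V p = edge_of V q.
Proof. by move/connect1/edge_of_connect. Qed.

Definition turn_perm x : 'S_4 := frame x * up_perm x * (frame (up x))^-1.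

Lemma up_glued x (e : medge) : v3 \notin val e ->
  edge_glued V (x.1, perm_medge (frame x) e)
    ((up x).1, perm_medge (frame (up x)) (perm_medge (turn_perm x) e)).
Proof.
move=> eN; apply/existsP; exists (frame x v3); rewrite mem_perm_medge eN /=.
by rewrite -!perm_medgeM /turn_perm mulgKV.
Qed.

(** A face cooriented outwards is crossed upwards; crossing one cooriented inwards is the inverse of
    such a gluing. *)
Lemma glued_up p q : edge_glued V p q -> exists x (e : medge),
  v3 \notin val e /\
  let p' := (x.1, perm_medge (frame x) e) in
  let q' := ((up x).1, perm_medge (frame (up x)) (perm_medge (turn_perm x) e))
    in
  (p = p' /\ q = q') \/ (p = q' /\ q = p').
Proof.
have up_case p1 q1 x : x.1 = p1.1 -> frame x v3 \notin val p1.2 ->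
    q1 = (glue_tet V p1.1 (frame x v3),
          perm_medge (glue_perm V p1.1 (frame x v3)) p1.2) ->
    exists2 e : medge, v3 \notin val e &
      p1 = (x.1, perm_medge (frame x) e) /\
      q1 = ((up x).1, perm_medge (frame (up x)) (perm_medge (turn_perm x) e)).
  case: p1 => t e /= xt xN ->; exists (perm_medge (frame x)^-1 e).
    by rewrite -(mem_perm_medge (frame x)) perm_medgeK.
  rewrite perm_medgeK xt; split=> //.
  by rewrite -!perm_medgeM /turn_perm mulgKV mulgA mulVg mul1g /up_perm -xt.
case/existsP => f /andP[fN /eqP qE].
have [out|inw] := boolP (outward V p.1 f).
  have [x xt xf] : exists2 x, x.1 = p.1 & frame x v3 = f.
    have := outwardE (p.1, false) ((frame (p.1, false))^-1 f).
    rewrite permKV out.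
    case: (ord4P ((frame (p.1, false))^-1 f)) => e; rewrite e //= => _.
      exists (p.1, true) => //.
      by rewrite (frame_flip (p.1, false)) permM swap4E -e permKV.
    by exists (p.1, false) => //; rewrite -e permKV.
  have [||e eN pq] := up_case p q x xt; rewrite ?xf //.
  by exists x, e; split=> //; left.
have [y yt yf] : exists2 y, y.1 = p.1 & frame y v0 = f.
  have := outwardE (p.1, false) ((frame (p.1, false))^-1 f).
  rewrite permKV (negbTE inw).
  case: (ord4P ((frame (p.1, false))^-1 f)) => e; rewrite e //= => _.
    by exists (p.1, false) => //; rewrite -e permKV.
  exists (p.1, true) => //.
  by rewrite (frame_flip (p.1, false)) permM swap4E -e permKV.
have [x xy] : exists x, up x = y.
  have [up' _ upK] := injF_bij up_inj; by exists (up' y).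
have [tx px] := up_glueK x; rewrite xy yf yt in tx px.
have fx : glue_perm V p.1 f f = frame x v3.
  by rewrite px -yf -xy frame_up permK.
have qx : q.1 = x.1 by rewrite qE.
have [|||e eN [qe pe]] := up_case q p x.
- by rewrite qx.
- by rewrite qE -fx mem_perm_medge.
- have := glue_permK V p.1 f; have := glue_tetK V p.1 f.
  rewrite qE fx /= => -> ->.
  by rewrite -perm_medgeM mulgV perm_medge1 -surjective_pairing.
by exists x, e; split=> //; right.
Qed.

Lemma turn_perm_odd x : odd_perm (turn_perm x).
Proof.
rewrite /turn_perm !odd_permM odd_permV (negbTE (frame_even x)).
by rewrite (negbTE (frame_even (up x))) addbF /=; apply: glue_odd.
Qed.

Lemma turn_perm3 x : turn_perm x v3 = v0.
Proof. by rewrite /turn_perm !permM -frame_up permK. Qed.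

Lemma up_edge x (e : medge) : v3 \notin val e ->
  edge_of V (x.1, perm_medge (frame x) e) =
  edge_of V ((up x).1, perm_medge (frame (up x)) (perm_medge (turn_perm x) e)).
Proof. by move=> eN; apply: edge_of_glued; apply: up_glued. Qed.

(* Of the three odd bijections between the glued faces, one would identify the
   red edge e02 with the blue edge e12; the other two are told apart by the
   colour of the top edge. *)
Lemma up_cases x :
  if tet_red x.1 then
    [/\ perm_medge (turn_perm x) e01 = e13, perm_medge (turn_perm x) e02 = e23
      & perm_medge (turn_perm x) e12 = e12]
  else
    [/\ perm_medge (turn_perm x) e01 = e12, perm_medge (turn_perm x) e02 = e13
      & perm_medge (turn_perm x) e12 = e23].
Proof.
have N01 : v3 \notin val e01 by rewrite !inE.
have N02 : v3 \notin val e02 by rewrite !inE.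
have [r b] := side_inc_flip (up x).
have topE : tet_red x.1 = red (edge_of V ((up x).1,
    perm_medge (frame (up x)) (perm_medge (turn_perm x) e01))).
  by rewrite -up_edge // frame_top.
case: (odd_perm4 (turn_perm_odd x) (turn_perm3 x)) => [] [p0 p1 p2].
- have e01E : perm_medge (turn_perm x) e01 = e12.
    by apply: perm_medge_pair; left.
  rewrite topE e01E [red _](red_side false) /=.
  by split=> //; apply: perm_medge_pair; left.
- have e01E : perm_medge (turn_perm x) e01 = e13.
    by apply: perm_medge_pair; right.
  rewrite topE e01E -r [red _](red_side true).
  by split=> //; apply: perm_medge_pair; first [by left | by right].
- have e02E : perm_medge (turn_perm x) e02 = e12.
    by apply: perm_medge_pair; right.
  have := red_side true x; rewrite /side_edge /side_inc /= up_edge // e02E.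
  by rewrite [red _](red_side false).
Qed.

Notation vturn := (turn up).

Lemma side_inc12 x k :
  ((up x).1, perm_medge (frame (up x)) (if k then e13 else e12)) =
  side_inc k (vturn k x).
Proof. by case: k => //=; case: (side_inc_flip (up x)). Qed.

Lemma side_inc21 x k :
  ((up x).1, perm_medge (frame (up x)) (if k then e12 else e13)) =
  side_inc (~~ k) (vturn (~~ k) x).
Proof. by case: k => //=; case: (side_inc_flip (up x)). Qed.

Lemma up_images x (e : medge) : v3 \notin val e ->
  let p := (x.1, perm_medge (frame x) e) in
  let q := ((up x).1, perm_medge (frame (up x)) (perm_medge (turn_perm x) e)) in
  let k := tet_red x.1 in
  [\/ p = top_inc x.1 /\ q = side_inc k (vturn k x),
      p = side_inc k x /\ q = bot_inc (up x).1
    | p = side_inc (~~ k) x /\ q = side_inc (~~ k) (vturn (~~ k) x)].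
Proof.
have top_ : (x.1, perm_medge (frame x) e01) = top_inc x.1.
  by rewrite frame_top.
have bot_ : ((up x).1, perm_medge (frame (up x)) e23) = bot_inc (up x).1.
  by rewrite frame_bottom.
have := up_cases x; have := side_inc12 x (tet_red x.1).
have := side_inc21 x (tet_red x.1).
case: (medgeP e) => [->|->|[]->|[]->]; rewrite ?inE //=;
  case: (tet_red x.1) => i21 i12 [m01 m02 m12] _; rewrite ?m01 ?m02 ?m12.
- by constructor 1.
- by constructor 1.
- by constructor 2.
- by constructor 3.
- by constructor 3.
- by constructor 2.
Qed.

Lemma up_incs x : let k := tet_red x.1 in
  [/\ edge_of V (top_inc x.1) = edge_of V (side_inc k (vturn k x)),
      edge_of V (side_inc k x) = edge_of V (bot_inc (up x).1)
    & edge_of V (side_inc (~~ k) x) =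
      edge_of V (side_inc (~~ k) (vturn (~~ k) x))].
Proof.
have N01 : v3 \notin val e01 by rewrite !inE.
have N02 : v3 \notin val e02 by rewrite !inE.
have N12 : v3 \notin val e12 by rewrite !inE.
move=> k; rewrite /top_inc -(frame_top x).
have := up_edge x N01; have := up_edge x N02; have := up_edge x N12.
have := side_inc12 x k; have := side_inc21 x k; have := up_cases x.
have := frame_bottom (up x).
rewrite -/k /bot_inc; case: (k) => <- [-> -> ->] s21 s12 -> -> -> /=.
  by rewrite s12 s21.
by rewrite s12 s21.
Qed.

(** By [glued_up] and [up_images] the three rules cover every gluing of incidences, and these
    generate the edge classes. *)
Lemma class_invariant (P : pred (T * medge)) :
  (forall x, let k := tet_red x.1 in
    [/\ P (top_inc x.1) = P (side_inc k (vturn k x)),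
        P (side_inc k x) = P (bot_inc (up x).1)
      & P (side_inc (~~ k) x) = P (side_inc (~~ k) (vturn (~~ k) x))]) ->
  forall p q, edge_of V p = edge_of V q -> P p = P q.
Proof.
move=> inv p q /edge_of_connect pq.
have closed_P : closed (edge_glued V) P.
  move=> {pq} {}p {}q /glued_up[x [e [eN pq]]].
  have [i1 i2 i3] := inv x; have := up_images x eN; move=> /= im.
  have : P (x.1, perm_medge (frame x) e) = P ((up x).1,
      perm_medge (frame (up x)) (perm_medge (turn_perm x) e)).
    by case: im => [] [-> ->].
  by case: pq => [] [-> ->].
exact: closed_connect closed_P _ _ pq.
Qed.

Lemma side_inc_inj k l x y : side_inc k x = side_inc l y -> k = l /\ x = y.
Proof.
(* The side edge of colour [k] of the face [(t, i)], read in the frame [(t, false)]. *)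
pose f (k i : bool) :=
  if k then if i then e13 else e02 else if i then e03 else e12.
have sideE m z : side_inc m z =
    (z.1, perm_medge (frame (z.1, false)) (f m z.2)).
  have [r b] := side_inc_flip (z.1, false).
  by case: z r b => t [] /= r b; case: m => //; rewrite -?r -?b.
rewrite !sideE => e; have /= xy := congr1 fst e; move: e; rewrite /= xy.
case: x y xy => t i [u j] /= -> /(congr1 snd) /perm_medge_inj /(congr1 val)
  /setP fe.
have := fe v0; have := fe v2.
by case: k {fe}; case: l; case: i; case: j; rewrite /= !inE.
Qed.

(** * Angle sums, fans, and the bijections given by top and bottom edges *)

Definition pi_inc p := is_pi V p.1 p.2.

Lemma pi_top t : pi_inc (top_inc t).
Proof. by rewrite /pi_inc is_piE eqxx. Qed.

Lemma pi_bot t : pi_inc (bot_inc t).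
Proof. by rewrite /pi_inc is_piE eqxx orbT. Qed.

Lemma pi_side k x : ~~ pi_inc (side_inc k x).
Proof.
rewrite /pi_inc is_piE -(frame_top x) -(frame_bottom x) /=.
rewrite !(inj_eq (@perm_medge_inj _)).
by apply/norP; split; apply/eqP => /(congr1 val)/setP se;
  have := se v0; have := se v1; case: k {se}; rewrite /= !inE.
Qed.

Lemma side_edge_turn k x :
  tet_red x.1 != k -> side_edge k x = side_edge k (vturn k x).
Proof.
have [_ _] := up_incs x.
by rewrite /side_edge; case: (tet_red _); case: k.
Qed.

Lemma top_edge_turn x :
  top_edge V x.1 = side_edge (tet_red x.1) (vturn (tet_red x.1) x).
Proof. by have [] := up_incs x. Qed.

Lemma side_edge_bot x :
  side_edge (tet_red x.1) x = bottom_edge V (up x).1.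
Proof. by have [] := up_incs x. Qed.

Definition pi_incs (E : edge V) : {set T * medge} :=
  [set p in val E | pi_inc p].

Lemma card_pi_incs E : #|pi_incs E| = 2.
Proof. by have [_ ->] := vt_taut V. Qed.

Lemma mem_pi_incs p E :
  (p \in pi_incs E) = (edge_of V p == E) && pi_inc p.
Proof. by rewrite inE mem_edge. Qed.

Lemma mem_top_inc t : top_inc t \in pi_incs (top_edge V t).
Proof.
by rewrite mem_pi_incs eqxx pi_top.
Qed.

Lemma mem_bot_inc t : bot_inc t \in pi_incs (bottom_edge V t).
Proof.
by rewrite mem_pi_incs eqxx pi_bot.
Qed.

(** If the orbit of [x] under [turn k] avoided colour [k], its incidences would be closed under
    gluing and form an edge class without angles pi, against the angle sum. *)
Lemma fan_finite k x : exists n, tet_red (iter n (vturn k) x).1 = k.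
Proof.
have [/existsP[y /andP[xy /eqP yk]]|none] :=
    boolP [exists y, fconnect (vturn k) x y && (tet_red y.1 == k)].
  by exists (findex (vturn k) x y); rewrite iter_findex.
have orbit y : fconnect (vturn k) x y -> tet_red y.1 = ~~ k.
  move=> xy; move/existsPn: none => /(_ y); rewrite xy /=.
  by case: (tet_red _); case: (k).
pose P p := [exists y, fconnect (vturn k) x y && (p == side_inc k y)].
have P_side l y : P (side_inc l y) = (l == k) && fconnect (vturn k) x y.
  apply/existsP/andP => [[z /andP[xz /eqP /side_inc_inj[-> ->]]]|[/eqP-> xy]].
    by rewrite eqxx.
  by exists y; rewrite xy eqxx.
have P_pi p : P p -> ~~ pi_inc p.
  by case/existsP => y /andP[_ /eqP ->]; apply: pi_side.
have P_top t : P (top_inc t) = false.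
  by apply/negbTE/negP => /P_pi; rewrite pi_top.
have P_bot t : P (bot_inc t) = false.
  by apply/negbTE/negP => /P_pi; rewrite pi_bot.
have connT y : fconnect (vturn k) x (vturn k y) = fconnect (vturn k) x y.
  by rewrite -same_fconnect1_r //; apply: turn_inj up_inj _.
have inv := @class_invariant P.
have /card_gt0P[p] : 0 < #|pi_incs (side_edge k x)| by rewrite card_pi_incs.
rewrite mem_pi_incs => /andP[/eqP pE pip].
suff Pp : P p by have := P_pi p Pp; rewrite pip.
rewrite (inv _ p (side_inc k x)) ?P_side ?eqxx ?connect0 // => y l.
rewrite P_top P_bot !P_side.
case: (eqVneq l k) => [lk|lk].
  have nxy : fconnect (vturn k) x y = false.
    by apply/negP => /orbit; rewrite -/l lk; case: (k).
  by rewrite lk connT nxy; split=> //; case: (k).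
have -> : ~~ l = k by move: lk; case: (l); case: (k).
by rewrite connT.
Qed.

Lemma top_is_bottom t : exists u, top_edge V t = bottom_edge V u.
Proof.
have [n [_ _ e]] := fan_end side_edge_turn top_edge_turn side_edge_bot
  fan_finite (t, true).
by exists (up (iter n.+1 (vturn (tet_red t)) (t, true))).1.
Qed.

(** Walk around the edge from a face [x] below [t]. From the first turn on, the side edge of colour
    [k] is a top edge; since [turn k] is a permutation, the walk returns to [x]. *)
Lemma bottom_is_top t : exists u, bottom_edge V t = top_edge V u.
Proof.
have [up' upK up'K] := injF_bij up_inj.
pose x := up' (t, true); pose k := tet_red x.1.
have fanP n y : tet_red y.1 = k ->
    exists u, side_edge k (iter n.+1 (vturn k) y) = top_edge V u.
  move=> yk; elim: n => [|n [u IH]]; first by exists y.1;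
    rewrite -yk top_edge_turn.
  rewrite iterS; set z := iter n.+1 _ y in IH *.
  case: (eqVneq (tet_red z.1) k) => [zk|zk].
    by exists z.1; rewrite top_edge_turn zk.
  by exists u; rewrite -side_edge_turn.
have [u e] := fanP (fingraph.order (vturn k) x).-1 x erefl.
exists u; rewrite -e prednK ?order_gt0 // iter_order;
  last exact: turn_inj up_inj _.
by rewrite side_edge_bot up'K.
Qed.

Lemma pi_incs_le2 E p q r : p \in pi_incs E -> q \in pi_incs E ->
  r \in pi_incs E -> uniq [:: p; q; r] -> False.
Proof.
move: (card_pi_incs E); move: (pi_incs E) => A cA pA qA rA /card_uniqP c3.
have : #|[:: p; q; r]| <= #|A|.
  apply/subset_leq_card/subsetP => s.
  by rewrite !inE => /or3P[]/eqP->; rewrite ?pA ?qA ?rA.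
by rewrite c3 cA.
Qed.

Lemma top_neq_bot_inc t u : top_inc t != bot_inc u.
Proof. by apply/eqP => -[<-] /esym/bottom_neq_top. Qed.

(** One of the two angles pi at an edge belongs to the tetrahedron above it, which leaves only one
    for a tetrahedron below. *)
Lemma top_edge_inj : injective (top_edge V).
Proof.
move=> t u tu; have [v tv] := top_is_bottom t.
apply/eqP; apply: contraT => ne; exfalso.
apply: (@pi_incs_le2 (top_edge V t) (top_inc t) (top_inc u) (bot_inc v)).
- exact: mem_top_inc.
- by rewrite tu mem_top_inc.
- by rewrite tv mem_bot_inc.
- rewrite /= !inE !negb_or !top_neq_bot_inc !andbT.
  by apply: contra ne => /eqP[->].
Qed.

Lemma bottom_edge_inj : injective (bottom_edge V).
Proof.
move=> t u tu; have [v tv] := bottom_is_top t.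
apply/eqP; apply: contraT => ne; exfalso.
apply: (@pi_incs_le2 (bottom_edge V t) (bot_inc t) (bot_inc u) (top_inc v)).
- exact: mem_bot_inc.
- by rewrite tu mem_bot_inc.
- by rewrite tv mem_top_inc.
- rewrite /= !inE !negb_or ![bot_inc _ == top_inc _]eq_sym.
  by rewrite !top_neq_bot_inc !andbT; apply: contra ne => /eqP[->].
Qed.

Lemma bottom_edge_surj E : exists t, bottom_edge V t == E.
Proof.
have /card_gt0P[p] : 0 < #|pi_incs E| by rewrite card_pi_incs.
rewrite mem_pi_incs => /andP[/eqP pE pip].
case: (incP p) => [e|e|[k [x [_ e]]]].
- have [u eu] := top_is_bottom p.1.
  by exists u; rewrite -eu -pE e.
- by exists p.1; rewrite -pE {2}e.
- by have := pi_side k x; rewrite -e pip.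
Qed.

Lemma bottom_edge_bij : bijective (bottom_edge V).
Proof.
exists (fun E => xchoose (bottom_edge_surj E)) => [t|E].
  by apply: bottom_edge_inj; apply/eqP/(xchooseP (bottom_edge_surj _)).
exact/eqP/(xchooseP (bottom_edge_surj _)).
Qed.

Lemma top_edge_surj E : exists t, top_edge V t == E.
Proof.
have [t /eqP <-] := bottom_edge_surj E.
by have [u ->] := bottom_is_top t; exists u.
Qed.

Lemma top_edge_bij : bijective (top_edge V).
Proof.
exists (fun E => xchoose (top_edge_surj E)) => [t|E].
  by apply: top_edge_inj; apply/eqP/(xchooseP (top_edge_surj _)).
exact/eqP/(xchooseP (top_edge_surj _)).
Qed.

Lemma tets_connected : connected_manifold V -> forall P : pred T,
  (forall x, P x.1 = P (up x).1) -> forall t u, P t = P u.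
Proof.
move=> [_ conn] P Pup t u; apply: (closed_connect _ (conn t u)).
move=> {}t {}u /existsP[f /eqP ->].
pose a := (frame (t, false))^-1 f.
have fa : f = frame (t, false) a by rewrite permKV.
have fl : frame (t, true) = swap4 * frame (t, false) by [].
have topP x : x.1 = t -> f = frame x v3 -> P t = P (glue_tet V t f).
  by move=> <- ->; rewrite [LHS]Pup.
have botP y : y.1 = t -> f = frame y v0 -> P t = P (glue_tet V t f).
  have [up' _ up'K] := injF_bij up_inj; rewrite -(up'K y) => <- ->.
  by have [-> _] := up_glueK (up' y); rewrite -Pup.
case: (ord4P a) fa => -> fa.
- exact: (botP (t, false)).
- by apply: (botP (t, true)) => //; rewrite fl permM swap4E.
- by apply: (topP (t, true)) => //; rewrite fl permM swap4E.
- exact: (topP (t, false)).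
Qed.

(** * Predecessor-closed sets and isolated edges *)

Lemma side_in_closed (S : {set edge V}) : connected_manifold V -> S != set0 ->
  (forall t, bottom_edge V t \in S -> top_edge V t \in S /\
     forall i, side_edge (~~ tet_red t) (t, i) \in S) ->
  forall x, side_edge (~~ tet_red x.1) x \in S.
Proof.
move=> conn S0 clS x.
have := no_bad up_inj side_edge_turn top_edge_turn side_edge_bot red_side
  top_edge_bij bottom_edge_bij fan_finite clS (tets_connected conn) S0 x.
by rewrite negbK.
Qed.

(* Equivalently, E has only one outgoing arrow in the flow graph. *)
Definition isolated (E : edge V) : Prop :=
  forall k x, side_edge k x = E -> k = tet_red x.1.

Definition side_incs (E : edge V) : {set T * medge} :=
  [set p in val E | ~~ pi_inc p].

Lemma size_side_tets E : size (side_tets E) = #|side_incs E|.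
Proof. by rewrite size_map -cardE. Qed.

Lemma mem_side_incs k x E :
  (side_inc k x \in side_incs E) = (side_edge k x == E).
Proof. by rewrite inE pi_side andbT mem_edge. Qed.

(** [D] consists of the side incidences of [E] in tetrahedra of its own colour, the two just below
    the tetrahedron with bottom edge [E]. Isolation means that there are no others. *)
Lemma isolatedE E : isolated E <-> size (side_tets E) = 2.
Proof.
have [up' upK up'K] := injF_bij up_inj.
have [t /eqP tE] := bottom_edge_surj E.
pose s x := side_inc (tet_red x.1) x.
pose y i := up' (t, i).
pose D := [set s (y true); s (y false)].
have DS : D \subset side_incs E.
  apply/subsetP => p /set2P[] ->; rewrite mem_side_incs side_edge_bot up'K;
  exact/eqP.
have cD : #|D| = 2.
  rewrite cards2; suff -> : s (y true) != s (y false) by [].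
  by apply/eqP => /side_inc_inj[_ /(can_inj up'K)].
rewrite size_side_tets; split=> [iso|cS].
  apply: etrans cD; apply: eq_card; apply/subset_eqP/andP; split=> //.
  apply/subsetP => p pS; have npi : ~~ pi_inc p by move: pS;
    rewrite inE => /andP[].
  case: (incP p) => [e|e|[k [x [_ e]]]];
    rewrite e ?pi_top ?pi_bot // in pS npi *.
  move: pS; rewrite mem_side_incs => /eqP xE; rewrite (iso _ _ xE).
  have xt : (up x).1 = t.
    by apply: bottom_edge_inj; rewrite tE -xE (iso _ _ xE) side_edge_bot.
  rewrite -(upK x); case: (up x) xt => u [] /= ->;
    rewrite /D !inE eqxx ?orbT //.
have SD : side_incs E = D by apply/esym/eqP; rewrite eqEcard DS cS cD.
move=> k x /eqP; rewrite -mem_side_incs SD.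
by case/set2P => /side_inc_inj[-> ->].
Qed.

(** * Arrows of the flow graph *)

Notation Phi := (flow_graph V).

Lemma flow_stepP (E F : edge V) : reflect
  (exists2 t, F = bottom_edge V t &
     E = top_edge V t \/ exists i, E = side_edge (~~ tet_red t) (t, i))
  (step (G := Phi) E F).
Proof.
apply: (iffP existsP) => [[[p pa] /= /andP[/eqP <- /eqP <-]]|[t -> E_t]].
  exists p.1 => //; case: (incP p) => [->|pe|[k [x [xp pe]]]]; [by left|..].
    have pip : pi_inc p by rewrite pe pi_bot.
    have /= p2 := congr1 snd pe; move: pa.
    by rewrite /flow_arrow -/(pi_inc p) pip orbF p2 => /eqP /bottom_neq_top.
  right; exists x.2; rewrite -xp -surjective_pairing.
  move: pa; rewrite /flow_arrow -/(pi_inc p) => /orP[/eqP p_top|/andP[_]].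
    have : pi_inc p by rewrite (surjective_pairing p) p_top; apply: pi_top.
    by rewrite pe (negbTE (pi_side _ _)).
  rewrite -xp -/(tet_red x.1) pe [red _](red_side k) /side_edge.
  by case: k {pe}; case: (tet_red x.1).
have arrow p : flow_arrow V p -> edge_of V p = E -> p.1 = t ->
    exists a : arrow Phi, (source a == E) && (target a == bottom_edge V t).
  by move=> pa pE pt; exists (exist _ p pa); rewrite /= pE pt !eqxx.
case: E_t => [E_t|[i E_t]].
  by apply: (arrow (top_inc t)) => //; rewrite /flow_arrow eqxx.
apply: (arrow (side_inc (~~ tet_red t) (t, i))) => //.
rewrite /flow_arrow pi_side red_side -/(tet_red t).
by case: (tet_red t); rewrite orbT.
Qed.

Lemma flow_step_top t : step (G := Phi) (top_edge V t) (bottom_edge V t).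
Proof. by apply/flow_stepP; exists t; [|left]. Qed.

Lemma flow_step_side t i :
  step (G := Phi) (side_edge (~~ tet_red t) (t, i)) (bottom_edge V t).
Proof. by apply/flow_stepP; exists t; [|right; exists i]. Qed.

Lemma isolated_step t F : isolated (top_edge V t) ->
  step (G := Phi) (top_edge V t) F -> F = bottom_edge V t.
Proof.
move=> iso /flow_stepP[u -> [/top_edge_inj ->//|[i /esym /iso /=]]].
by case: (tet_red u).
Qed.

Lemma side_not_isolated t i : ~ isolated (side_edge (~~ tet_red t) (t, i)).
Proof. by move/(_ _ _ erefl) => /=; case: (tet_red t). Qed.

(** * Reachability and strongly connected components *)

Lemma reaches_ind (G : digraph) (P : vertex G -> Prop) v w :
  (forall a b, P a -> step a b -> P b) -> P v -> reaches v w -> P w.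
Proof.
move=> Pstep Pv /connectP[p pth ->]; elim: p v Pv pth => //= a p IH v Pv.
by case/andP => va; apply/IH/(Pstep _ _ Pv va).
Qed.

Lemma scc_eq (G : digraph) (v w : vertex G) : w \in scc v -> scc v = scc w.
Proof.
rewrite inE => /andP[vw wv]; apply/setP => x; rewrite !inE.
apply/andP/andP => -[a b]; split.
- exact: connect_trans wv a.
- exact: connect_trans b vw.
- exact: connect_trans vw a.
- exact: connect_trans b wv.
Qed.

Definition comp_of (G : digraph) (v : vertex G) : component G :=
  exist _ (scc v) (imset_f _ isT).

Lemma mem_comp_of (G : digraph) (v : vertex G) : v \in val (comp_of v).
Proof. by rewrite inE /reaches connect0. Qed.

Lemma comp_ofE (G : digraph) (B : component G) v :
  v \in val B -> B = comp_of v.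
Proof.
case: B => C CB /= vC; apply: val_inj => /=; case/imsetP: (CB) => w _ Cw.
by rewrite Cw in vC *; apply: scc_eq.
Qed.

Lemma quotient_edgeE (G : digraph) (v w : vertex G) :
  reaches v w -> comp_of v != comp_of w ->
  quotient_edge (comp_of v) (comp_of w).
Proof.
move=> vw ne; rewrite /quotient_edge ne; apply/exists_inP.
exists v; first exact: mem_comp_of.
by apply/exists_inP; exists w; first exact: mem_comp_of.
Qed.

(** A nonisolated edge is the third edge of some face, and [side_in_closed] puts all third edges in
    [S]. *)
Lemma nonisolated_mem (S : {set edge V}) (E : edge V) :
  connected_manifold V -> S != set0 ->
  (forall F G : edge V, step (G := Phi) F G -> G \in S -> F \in S) ->
  ~ isolated E -> E \in S.
Proof.
move=> conn S0 clS niso; apply: contraT => ES; case: niso => k x xE.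
have xS : side_edge (~~ tet_red x.1) x \in S.
  apply: side_in_closed => // t tS; split;
    first exact: clS (flow_step_top t) tS.
  by move=> i; apply: clS (flow_step_side t i) tS.
apply/eqP; apply: contraNT ES => kx; rewrite -xE.
by have -> : k = ~~ tet_red x.1 by move: kx; case: k {xE}; case: (tet_red _).
Qed.

(** * Infinitesimal components as vertical cycles *)

Definition next_tet t : T := xchoose (top_edge_surj (bottom_edge V t)).

Lemma top_next t : top_edge V (next_tet t) = bottom_edge V t.
Proof. exact/eqP/(xchooseP (top_edge_surj _)). Qed.

Lemma next_tet_inj : injective next_tet.
Proof.
by move=> t u tu; apply: bottom_edge_inj; rewrite -!top_next tu.
Qed.

Lemma reaches_iter_next t n :
  reaches (G := Phi) (bottom_edge V t) (bottom_edge V (iter n next_tet t)).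
Proof.
elim: n => [|n IH]; first exact: connect0.
apply: connect_trans IH (connect1 _).
by rewrite iterS -top_next; apply: flow_step_top.
Qed.

(** The edges not reached from [E] form a predecessor-closed set, nonempty because [E] does not
    reach back into [A]; it would contain [F] if [F] were not isolated. *)
Lemma infinitesimal_isolated (B : component Phi) E : connected_manifold V ->
  infinitesimal B -> E \in val B ->
  forall F, reaches (G := Phi) E F -> isolated F.
Proof.
move=> conn [A /andP[AB /exists_inP[v vA /exists_inP[w wB vw]]]] EB F EF k x xF.
pose S := [set G : edge V | ~~ reaches (G := Phi) E G].
apply/eqP; apply: contraT => kx.
have : F \in S.
  apply: nonisolated_mem => //; last 2 first.
  - move=> G H GH; rewrite !inE; apply: contra => EG.
    exact: connect_trans EG (connect1 GH).
  - by move/(_ k x xF) => ke; rewrite ke eqxx in kx.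
  apply/set0Pn; exists v; rewrite inE; apply: contra AB => Ev.
  have Ew : w \in scc (G := Phi) E.
    by move: wB; rewrite {1}(comp_ofE EB).
  rewrite (comp_ofE vA) (comp_ofE EB); apply/eqP/val_inj/esym/scc_eq.
  rewrite inE Ev /=; move: Ew; rewrite inE => /andP[_ wE].
  exact: connect_trans vw wE.
by rewrite inE EF.
Qed.

Lemma reaches_isolated t F :
  (forall G, reaches (G := Phi) (bottom_edge V t) G -> isolated G) ->
  reaches (G := Phi) (bottom_edge V t) F ->
  exists n, F = bottom_edge V (iter n next_tet t).
Proof.
move=> iso; pose P (G : edge V) := exists n,
  G = bottom_edge V (iter n next_tet t).
apply: (reaches_ind (G := Phi) (P := P)); last by exists 0.
move=> _ G [n ->] nG; exists n.+1; apply: isolated_step.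
  by rewrite iterS top_next; apply/iso/reaches_iter_next.
by rewrite iterS top_next.
Qed.

Lemma iter_next_mod t n :
  iter n next_tet t = iter (n %% fingraph.order next_tet t) next_tet t.
Proof.
set h := fingraph.order _ _; rewrite {1}(divn_eq n h) addnC iterD.
by congr iter; elim: (n %/ h) => // m IH;
  rewrite mulSn iterD IH iter_order //; apply: next_tet_inj.
Qed.

Lemma infinitesimal_vertical (B : component Phi) t : connected_manifold V ->
  infinitesimal B -> bottom_edge V t \in val B ->
  forall F : edge V, reaches (G := Phi) (bottom_edge V t) F = (F \in val B).
Proof.
move=> conn infB tB F; have iso := infinitesimal_isolated conn infB tB.
rewrite [in RHS](comp_ofE tB) [RHS]inE; apply/idP/andP => [tF|[//]].
split=> //; have [n ->] := reaches_isolated iso tF; rewrite iter_next_mod.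
set h := fingraph.order _ _; set m := n %% h.
have mh : m < h by rewrite ltn_mod; apply: fingraph.order_gt0.
(* The remaining [h - m] steps of the cycle of [next_tet] lead back to [t]. *)
rewrite -{2}(iter_order next_tet_inj t) -/h -(subnK (ltnW mh)) iterD.
exact: reaches_iter_next.
Qed.

(** * Infinitesimal cycles of walls *)

Lemma val_iter_ordS h n (j : 'I_h) : val (iter n (@ordS h) j) = (j + n) %% h.
Proof.
elim: n => [|n IH]; first by rewrite addn0 modn_small.
by rewrite iterS /= IH -addn1 modnDml addn1 addnS.
Qed.

Lemma infinitesimal_is_wall (B : component Phi) : connected_manifold V ->
  infinitesimal B -> infinitesimal_cycle (val B).
Proof.
move=> conn infB.
have [E EB] : exists E : edge V, E \in val B.
  by case: infB => A /andP[_ /exists_inP[v _ /exists_inP[w wB _]]]; exists w.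
have [t /eqP tE] := bottom_edge_surj E; rewrite -tE in EB.
have iso := infinitesimal_isolated conn infB EB.
pose h := fingraph.order next_tet t; pose u n := iter n next_tet t.
(* Column 2 is the vertical cycle. As 2 is even, its neighbours carry the index [ordS j], so columns
   1 and 3 at [j] are the side tetrahedra of the top edge of [u j]. There are two of them, so the
   default [t] never shows. *)
pose w (i : nat) (j : 'I_h) :=
  if i == 2 then u j else nth t (side_tets (top_edge V (u j))) (i == 3).
have uS (j : 'I_h) : u (ordS j) = next_tet (u j).
  by rewrite -[RHS]/(u j.+1) [RHS]iter_next_mod.
exists 2, h, w, 2; split=> //; last first.
  apply/setP => F; rewrite -(infinitesimal_vertical conn infB EB).
  apply/idP/imsetP => [/(reaches_isolated iso)[n ->]|[j _ ->]]; last first.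
    exact: reaches_iter_next.
  have nh : n %% h < h by rewrite ltn_mod; apply: fingraph.order_gt0.
  by exists (Ordinal nh) => //; rewrite /w /= /u -iter_next_mod.
split=> //; first exact: fingraph.order_gt0.
- move=> i j; rewrite -eqn_leq => /eqP <-.
  by rewrite /w /= uS top_next.
- move=> i j; rewrite -eqn_leq => /eqP <- /=.
  rewrite /w /= uS top_next.
  have /isolatedE : isolated (bottom_edge V (u j)).
    exact/iso/reaches_iter_next.
  by case: (side_tets _) => [|a [|b [|]]].
(* Column 2 alone already has least period [h]. *)
- move=> d /andP[d0 dh] per.
  have := per 2 (Ordinal (fingraph.order_gt0 next_tet t)) isT.
  rewrite /w /= val_iter_ordS add0n modn_small // => ud.
  by have := findex_iter dh; rewrite [iter d _ _]ud findex0 => d00;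
    rewrite -d00 in d0.
Qed.

(** Edges with two side tetrahedra are isolated, so no arrow leaves the cycle. *)
Lemma wall_infinitesimal (C : {set edge V}) : infinitesimal_cycle C ->
  exists B : component Phi, infinitesimal B /\ C = val B.
Proof.
case=> w [h [t [i [[_ h0 bt sides _] iw CE]]]].
pose b j := bottom_edge V (t i j).
have iso j : isolated (b j).
  by apply/isolatedE; rewrite (perm_size (sides i j iw)).
have bS j : step (G := Phi) (b j) (b (ordS j)).
  by rewrite /b bt //; apply: flow_step_top.
pose j0 := Ordinal h0.
have b0j j : reaches (G := Phi) (b j0) (b j).
  have -> : j = iter j (@ordS h) j0.
    by apply: val_inj; rewrite val_iter_ordS add0n modn_small.
  elim: {j}(val j) => [|n IH]; first exact: connect0.
  by apply: connect_trans IH (connect1 _); rewrite iterS.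
have bj0 j : reaches (G := Phi) (b j) (b j0).
  have -> : j0 = iter (h - j) (@ordS h) j.
    by apply: val_inj; rewrite val_iter_ordS subnKC ?modnn // ltnW.
  elim: (h - j) => [|n IH]; first exact: connect0.
  by apply: connect_trans IH (connect1 _); rewrite iterS.
have bC F : reaches (G := Phi) (b j0) F -> exists j, F = b j.
  apply: (reaches_ind (G := Phi) (P := fun G => exists j, G = b j)).
    2: by exists j0.
  move=> _ G [j ->] jG; exists (ordS j); apply: isolated_step.
    by rewrite -bt //; apply: iso.
  by rewrite -bt.
exists (comp_of (G := Phi) (b j0)); split; last first.
  rewrite CE; apply/setP => F; rewrite [RHS]inE; apply/imsetP/andP.
    by case=> j _ ->; split; [exact: b0j | exact: bj0].
  by case=> /bC[j ->] _; exists j.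
(* This edge flows into the cycle but is not on it, as it is not isolated. *)
pose Q := side_edge (~~ tet_red (t i j0)) (t i j0, true).
exists (comp_of (G := Phi) Q); apply: quotient_edgeE.
  exact/connect1/flow_step_side.
apply/eqP => /(congr1 val) /= QE.
have : Q \in scc (G := Phi) (b j0) by rewrite -QE; apply: mem_comp_of.
rewrite inE => /andP[/bC[j Qj] _].
by apply: (@side_not_isolated (t i j0) true); rewrite -/Q Qj; apply: iso.
Qed.

(** * The tree of components *)

Lemma quotient_tree : connected_manifold V ->
  rooted_height1_tree (@quotient_edge Phi).
Proof.
move=> conn; have [/card_gt0P[t _] _] := conn.
(* The root is the component of a nonisolated edge; infinitesimal components contain only isolated
   ones. *)
pose Q := side_edge (~~ tet_red t) (t, true).
have nQ : ~ isolated Q by apply: side_not_isolated.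
pose r := comp_of (G := Phi) Q.
have inf_iso (B : component Phi) E :
  infinitesimal B -> E \in val B -> isolated E.
  by move=> infB EB; apply: (infinitesimal_isolated conn infB EB);
    apply: connect0.
have r_src (A : component Phi) : ~~ quotient_edge A r.
  apply/negP => Ar; apply: nQ; apply: (inf_iso r); first by exists A.
  exact: mem_comp_of.
(* A component without incoming edges is predecessor-closed, hence contains [Q]. *)
have src_r (A : component Phi) : (forall B, ~~ quotient_edge B A) -> A = r.
  move=> srcA; apply: comp_ofE; apply: nonisolated_mem => //.
    by case: A {srcA} => A /= /imsetP[v _ ->]; apply/set0Pn; exists v;
      apply: (mem_comp_of (G := Phi)).
  move=> F G FG GA; apply: contraT => FA.
  have AE : A = comp_of (G := Phi) G by apply: comp_ofE.
  have := srcA (comp_of (G := Phi) F); rewrite AE quotient_edgeE //.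
    exact: connect1.
  apply: contra FA => /eqP FGe; rewrite AE -FGe.
  exact: (mem_comp_of (G := Phi)).
(* Otherwise [A] would be infinitesimal, and its edges reach nothing outside [A]. *)
have from_r (A B : component Phi) : quotient_edge A B -> A = r.
  move=> AB; apply: src_r => C; apply/negP => CA.
  have infA : infinitesimal A by exists C.
  case/andP: AB => neq /exists_inP[v vA /exists_inP[w wB vw]].
  have [u /eqP uv] := bottom_edge_surj v.
  rewrite -uv in vA vw.
  rewrite (infinitesimal_vertical conn infA vA) in vw.
  by rewrite (comp_ofE vw) (comp_ofE wB) eqxx in neq.
have r_to (B : component Phi) : B <> r -> quotient_edge r B.
  move=> Br; have [/existsP[A AB]|/existsPn srcB] :=
    boolP [exists A, quotient_edge A B]; last by case: Br; apply: src_r.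
  by rewrite -(from_r A B AB).
exists r; split; last exact: from_r.
split=> // r' r'P; apply/eqP; apply: contraT => /eqP rr'.
by have := r'P r rr'; rewrite (negbTE (r_src r')).
Qed.

End Frames.

Local Close Scope group_scope.

Theorem theorem3p5 (T : finType) (V : veering_triangulation T)
    (conn : connected_manifold V) :
  (forall C : {set edge V},
     (exists B : component (flow_graph V), infinitesimal B /\ C = sval B) <->
     infinitesimal_cycle C) /\
  rooted_height1_tree (@quotient_edge (flow_graph V)).
Proof.
split=> [C|]; last exact: quotient_tree.
split=> [[B [infB ->]]|]; last exact: wall_infinitesimal.
exact: infinitesimal_is_wall.
Qed.
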